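(* Let $k$ be an odd positive integer and let $A$ be a group isomorphic either to $C_k$ or to $C_k \times C_3$. Let $R = A \rtimes \langle r\rangle$, where $r$ has order $8$ and $r^{-1}ar = a^{-1}$ for every $a \in A$. Then $R$ does not have the DCI property.
   Context: For a group $G$ and a subset $S \subseteq G$, the Cayley digraph $\mathrm{Cay}(G,S)$ has vertex set $G$ and an arc from $g$ to $sg$ for every $g\in G$, $s \in S$. A Cayley digraph $\mathrm{Cay}(G,S)$ has the DCI (Directed Cayley Isomorphism) property if for every $T \subseteq G$ with $\mathrm{Cay}(G,T) \cong \mathrm{Cay}(G,S)$ there is an automorphism $\alpha \in \mathrm{Aut}(G)$ with $S^\alpha = T$. A group $G$ has the DCI property if every Cayley digraph on $G$ has the DCI property. $C_m$ denotes the cyclic group of order $m$. *)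

(* Defs.v *)
From mathcomp Require Import all_boot all_fingroup.

Set Implicit Arguments.
Unset Strict Implicit.
Unset Printing Implicit Defensive.

Local Open Scope group_scope.

(* A digraph, possibly with loops, is a vertex set V : {set T} in a finite type
   together with a relation e : rel T of which only the restriction to V
   matters. *)
Definition digraph_isomorphic (T1 T2 : finType)
    (V1 : {set T1}) (e1 : rel T1) (V2 : {set T2}) (e2 : rel T2) : Prop :=
  exists f : T1 -> T2,
    [/\ {in V1 &, injective f},
        f @: V1 = V2
      & {in V1 &, forall x y, e2 (f x) (f y) = e1 x y}].

Definition cayley_arc (gT : finGroupType) (S : {set gT}) : rel gT :=
  fun g h => [exists s in S, h == s * g].

Definition cayley_isomorphic (gT : finGroupType) (G : {group gT})
    (S T : {set gT}) : Prop :=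
  digraph_isomorphic G (cayley_arc S) G (cayley_arc T).

Definition cayley_DCI (gT : finGroupType) (G : {group gT}) (S : {set gT})
    : Prop :=
  forall T : {set gT}, T \subset G -> cayley_isomorphic G T S ->
    exists2 alpha : {perm gT}, alpha \in Aut G & alpha @: S = T.

Definition group_DCI (gT : finGroupType) (G : {group gT}) : Prop :=
  forall S : {set gT}, S \subset G -> cayley_DCI G S.

(* Main.v *)
(* Any finite group G with an element r of order 8 fails the DCI property.
   Take S = {r, r^5, r^2} and T = {r, r^5, r^6}.  No automorphism maps S onto T,
   since no element of T has its square in T.  On the other hand, 2-colour G
   so that x and r^2 x always get opposite colours, and multiply one colour class
   by r^4: arcs in {r, r^5} are permuted among themselves, while arcs in r^2,
   which change the colour, become arcs in r^6 and conversely. *)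
Require Import Defs.
From mathcomp Require Import all_boot all_fingroup all_algebra.
From mathcomp Require Import cyclic.

Set Implicit Arguments.
Unset Strict Implicit.
Unset Printing Implicit Defensive.

Local Open Scope group_scope.

Section OrderEight.

Variables (gT : finGroupType) (r : gT).
Hypothesis r_order : #[r] = 8.

Let eq_expr m n : (r ^+ m == r ^+ n) = (m == n %[mod 8]).
Proof. by rewrite eq_expg_mod_order r_order. Qed.

Let expr_mod m n : m = n %[mod 8] -> r ^+ m = r ^+ n.
Proof. by move/eqP; rewrite -eq_expr => /eqP. Qed.

(* The powers r^i, i < 8, with i./2 odd. *)
Definition cycle_colour (h : gT) : bool :=
  h \in [set r ^+ 2; r ^+ 3; r ^+ 6; r ^+ 7].

(** Adding 2 to the exponent raises its half by 1, and reduction mod 8 shifts the half by the even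
    number 4, so the parity flips. *)
Lemma cycle_colour_mul2 h : h \in <[r]> ->
  cycle_colour (r ^+ 2 * h) = ~~ cycle_colour h.
Proof.
rewrite /cycle_colour => /cyclePmin[i]; rewrite r_order => lt_i8 ->.
rewrite -expgD !inE !eq_expr.
by move: i lt_i8; do 8 case=> //.
Qed.

(** A chosen base point in each right coset of [<[r]>] carries the colouring of the cycle over to
    that coset. *)
Definition colour (x : gT) : bool := cycle_colour (x * (repr (<[r]> :* x))^-1).

Lemma colour_mul2 x : colour (r ^+ 2 * x) = ~~ colour x.
Proof.
rewrite /colour rcosetM rcoset_id ?mem_cycle // -mulgA cycle_colour_mul2 //.
by rewrite -mem_rcoset rcoset_sym mem_repr_rcoset.
Qed.

Lemma colour_mul4 x : colour (r ^+ 4 * x) = colour x.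
Proof. by rewrite (expgD r 2 2) -mulgA !colour_mul2 negbK. Qed.

Definition twist (x : gT) : gT := r ^+ (4 * colour x) * x.

(** Multiplication by r^4 keeps the colour, so the second twist repeats the factor of the first, and
    r^8 = 1. *)
Lemma twistK : involutive twist.
Proof.
move=> x; have colour_twist: colour (twist x) = colour x.
  by rewrite /twist; case: {1}(colour x); rewrite ?colour_mul4 ?mul1g.
rewrite {1}/twist colour_twist mulgA -expgD (@expr_mod _ 0) ?mul1g //.
by case: (colour x).
Qed.

Lemma twist_in (G : {group gT}) x : r \in G -> x \in G -> twist x \in G.
Proof. by move=> rG xG; rewrite groupM ?groupX. Qed.

Definition conn n : {set gT} := [set r; r ^+ 5; r ^+ n].

Lemma cayley_arcP (S : {set gT}) x y :
  reflect (exists2 s, s \in S & y = s * x) (cayley_arc S x y).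
Proof.
by apply: (iffP exists_inP) => -[s sS /eqP e]; exists s => //; apply/eqP.
Qed.

Lemma twist_arc_odd x i : i \in [:: 1; 5]%N ->
  exists2 j, j \in [:: 1; 5]%N & twist (r ^+ i * x) = r ^+ j * twist x.
Proof.
move=> i15; set c := colour (r ^+ i * x) (+) colour x.
(* The factors at the two ends cancel unless the colours differ; then r^4 remains, and adding 4
   swaps 1 and 5 mod 8. *)
exists ((i + 4 * c) %% 8)%N.
  by case: c; move: i15; rewrite !inE => /orP[]/eqP->.
rewrite /twist !mulgA -!expgD; congr (_ * _); apply: expr_mod.
rewrite modnDml {}/c.
by case: (colour (_ * _)); case: (colour x); move: i15;
  rewrite !inE => /orP[]/eqP->.
Qed.

Lemma twist_mul2 x : twist (r ^+ 2 * x) = r ^+ 6 * twist x.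
Proof.
rewrite /twist colour_mul2 !(mulgA (r ^+ _) (r ^+ _)) -!expgD; congr (_ * _); apply: expr_mod.
by case: (colour x).
Qed.

(** This is [twist_mul2] conjugated by the involution [twist]. *)
Lemma twist_mul6 x : twist (r ^+ 6 * x) = r ^+ 2 * twist x.
Proof. by rewrite -{1}[x]twistK -twist_mul2 twistK. Qed.

Lemma connP n s :
  reflect (s = r ^+ n \/ exists2 i, i \in [:: 1; 5]%N & s = r ^+ i)
          (s \in conn n).
Proof.
rewrite !inE -[X in s == X]expg1; apply: (iffP orP).
  case=> [/orP[]|] /eqP->; [right | right | by left].
    by exists 1%N.
  by exists 5.
case=> [->|[i]]; first by right.
by rewrite !inE => /orP[]/eqP-> ->; left; rewrite eqxx ?orbT.
Qed.

(** Keeping m and n general serves both directions of the isomorphism, (2, 6) and (6, 2). *)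
Lemma twist_arc m n x y : (forall z, twist (r ^+ m * z) = r ^+ n * twist z) ->
  cayley_arc (conn m) x y -> cayley_arc (conn n) (twist x) (twist y).
Proof.
move=> twist_mn /cayley_arcP[s /connP s_m ->]; apply/cayley_arcP.
case: s_m => [->|[i /(twist_arc_odd x)[j j15 eq_j] ->]].
  by exists (r ^+ n); rewrite ?twist_mn //; apply/connP; left.
by exists (r ^+ j) => //; apply/connP; right; exists j.
Qed.

Lemma conn6_iso_conn2 (G : {group gT}) : r \in G ->
  cayley_isomorphic G (conn 6) (conn 2).
Proof.
move=> rG; exists twist; split.
- by move=> x y _ _; apply: (can_inj twistK).
- apply/setP=> x; apply/imsetP/idP => [[y yG ->]|xG]; first exact: twist_in.
  by exists (twist x); rewrite ?twistK ?twist_in.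
- move=> x y _ _; apply/idP/idP; last exact/twist_arc/twist_mul6.
  by move/(twist_arc twist_mul2); rewrite !twistK.
Qed.

(** The squares of r, r^5, r^6 are r^2, r^2, r^4. *)
Lemma conn6_sqr x : x \in conn 6 -> x ^+ 2 \notin conn 6.
Proof.
by rewrite !inE -[X in _ == X]expg1 -orbA => /or3P[]/eqP->;
  rewrite -expgM -[X in _ == X]expg1 !eq_expr.
Qed.

Lemma order8_not_DCI (G : {group gT}) : r \in G -> ~ group_DCI G.
Proof.
move=> rG dciG.
have sub (n : nat) : conn n \subset G.
  by apply/subsetP=> x; rewrite !inE -orbA => /or3P[]/eqP->; rewrite ?groupX.
have [a aG aST] := dciG _ (sub 2) _ (sub 6) (conn6_iso_conn2 rG).
have aT x : x \in conn 2 -> a x \in conn 6 by rewrite -aST; apply: imset_f.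
have /conn6_sqr/negP[] : a r \in conn 6 by apply: aT; rewrite !inE eqxx.
(* The square of [a r] is the image of r^2, which lies in [conn 2]. *)
rewrite -(autmE aG) -morphX //= autmE; apply: aT.
by rewrite !inE eqxx orbT.
Qed.

End OrderEight.

Theorem theorem1p1 (gT : finGroupType) (R A : {group gT}) (r : gT) (k : nat)
    (k_odd : odd k)
    (A_type : A \isog Zp k \/ A \isog setX (Zp k) (Zp 3))
    (R_sdprod : A ><| <[r]> = R)
    (r_order : #[r] = 8)
    (r_inverts : forall a : gT, a \in A -> r^-1 * a * r = a^-1) :
  ~ group_DCI R.
Proof.
apply: (order8_not_DCI r_order).
by have [_ <- _ _] := sdprodP R_sdprod;
  rewrite (subsetP (mulG_subr _ _)) ?cycle_id.
Qed.
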